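(* For $\theta>0$ and $\tau>0$ let $g(\theta,\tau)=\vartheta_3(0,e^{-\theta\tau})-\vartheta_3(\theta,e^{-\theta\tau})$, where $\vartheta_3(z,q)=1+2\sum_{n=1}^\infty q^{n^2}\cos(2nz)$. Then for every $\delta>0$, $$\lim_{\theta\downarrow0}\frac{\int_\delta^\infty g(\theta,\tau)\,\mathrm d\tau}{\int_0^\infty g(\theta,\tau)\,\mathrm d\tau}=0.$$
   Context: In the paper $\theta=\pi\gamma^2/4$ with $\gamma\in(0,2)$; only small $\theta>0$ matters for the statement. *)

(* Defs.v *)
From mathcomp Require Import all_boot all_order all_algebra.
From mathcomp Require Import all_classical all_reals all_analysis.

Set Implicit Arguments.
Unset Strict Implicit.
Unset Printing Implicit Defensive.

Import Order.TTheory GRing.Theory Num.Theory.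
Import numFieldNormedType.Exports.

Local Open Scope classical_set_scope.
Local Open Scope ring_scope.

(* Real argument z; the series converges for `|q| < 1, the only range used. *)
Definition theta3 (R : realType) (z q : R) : R :=
  1 + 2 * limn (fun N : nat =>
    \sum_(1 <= n < N) q ^+ (n ^ 2)%N * cos (2 * n%:R * z)).

Definition g (R : realType) (theta tau : R) : R :=
  theta3 0 (expR (- (theta * tau))) - theta3 theta (expR (- (theta * tau))).

(* Main.v *)
Require Import Defs.
From mathcomp Require Import all_boot all_order all_algebra.
From mathcomp Require Import all_classical all_reals all_analysis.
From mathcomp Require Import measurable_realfun ring lra.
Set Implicit Arguments.
Unset Strict Implicit.
Unset Printing Implicit Defensive.

Import Order.TTheory GRing.Theory Num.Theory.
Import numFieldNormedType.Exports.
Local Open Scope classical_set_scope.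
Local Open Scope ring_scope.

(** Subtracting the two theta series gives
      g theta tau = sum_n 4 sin^2(n theta) exp(- theta n^2 tau) >= 0,
    and integrating this positive series term by term over tau > d gives
      sum_n 4 sin^2(n theta) exp(- theta n^2 d) / (theta n^2)     ([integral_g]).

    The total mass (d = 0) stays away from 0 as theta -> 0: about 1/theta
    modes have n theta <= 1, and for these sin(n theta) is comparable to
    n theta, so that each of them contributes a constant times theta
    ([integral_g_total_ge]).  For theta < pi the total mass is in fact
    2 (pi - theta), but a positive lower bound suffices.

    The mass beyond delta > 0 vanishes.  Since sin^2(n theta) <= n^2 theta^2,
    mode n contributes at most 4 theta; since moreover
    exp(- y) <= 1/y with y = theta n^2 delta, it contributes at most
    4 / (delta n^2), uniformly in theta.  Using the first bound for n < N and
    the second one for n >= N, the mass is at most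
    4 N theta + 8 / (delta N) ([integral_g_tail_le]).  Taking N large, and
    then theta small, makes this smaller than any given positive number.

    At d = 0 the bound sin^2 <= 1 leaves at most 4 / (theta n^2) for mode n,
    whence the total mass is finite and g is integrable. *)

(** * Quadratic bounds on the sine *)

Lemma sin_MVT (R : realType) (x : R) :
  0 <= x -> exists2 c, c \in `[0, x] & sin x = cos c * x.
Proof.
move=> x0; have [|c cx] := @MVT_segment R sin cos 0 x x0 (fun y _ => is_derive_sin y).
  by apply: continuous_subspaceT; exact: continuous_sin.
by rewrite sin0 !subr0 => ->; exists c.
Qed.

Lemma sqr_sin_le_sqr (R : realType) (x : R) : 0 <= x -> sin x ^+ 2 <= x ^+ 2.
Proof.
move=> /sin_MVT[c _ ->]; rewrite exprMn; apply: ler_piMl; first exact: sqr_ge0.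
by have := cos2Dsin2 c; have := sqr_ge0 (sin c); lra.
Qed.

(** On `[0, 1] the derivative of the sine is at least cos 1, which is positive
    because 1 < pi / 2. *)
Lemma sqr_sin_ge (R : realType) (x : R) :
  0 <= x <= 1 -> (cos 1 * x) ^+ 2 <= sin x ^+ 2.
Proof.
move=> /andP[x0 x1]; have [c] := @sin_MVT R x x0.
rewrite in_itv/= => /andP[c0 cx] ->.
have cos1 : cos 1 <= cos c :> R.
  have pi1 := pi_ge2 R.
  by rewrite leNgt ltr_cos ?in_itv/= -?leNgt//; lra.
have := @cos1_gt0 R => cos0.
have cos0c : 0 <= cos c by exact: le_trans (ltW cos0) cos1.
by rewrite lerXn2r ?nnegrE ?mulr_ge0 ?ler_wpM2r// ltW.
Qed.

(** * Series bounded by a constant, then by an inverse square *)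

(** Telescoping, from 1/n^2 <= 2/(n (n + 1)) = 2 (1/n - 1/(n + 1)). *)
Lemma sum_inv_sqr_le (R : realFieldType) (N k : nat) : (0 < N)%N ->
  \sum_(N <= n < N + k) (n%:R ^+ 2)^-1 <= 2 * (N%:R^-1 - (N + k)%:R^-1) :> R.
Proof.
move=> N0; elim: k => [|k IH]; first by rewrite addn0 big_geq// subrr mulr0.
rewrite addnS big_nat_recr ?leq_addr//=.
apply: (le_trans (lerD IH (lexx _))).
set x : R := (N + k)%:R; have x1 : 1 <= x by rewrite ler1n addn_gt0 N0.
rewrite -[(N + k).+1%:R]natr1 -/x -lerBrDl.
have -> : 2 * (N%:R^-1 - (x + 1)^-1) - 2 * (N%:R^-1 - x^-1) = 2 / (x * (x + 1)).
  by field; apply/and3P; split; rewrite ?pnatr_eq0 -?lt0n// ?gt_eqF//; lra.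
rewrite ler_pdivlMr; last by nra.
rewrite ler_pdivrMl; last by nra.
by nra.
Qed.

Lemma nneseries_le_head_tail (R : realType) (a : nat -> R) (A B : R) (N : nat) :
  (0 < N)%N -> 0 <= B -> (forall n, 0 <= a n) ->
  (forall n, (n < N)%N -> a n <= A) ->
  (forall n, (N <= n)%N -> a n <= B / n%:R ^+ 2) ->
  (\sum_(0 <= n <oo) (a n)%:E <= (N%:R * A + 2 * B / N%:R)%:E)%E.
Proof.
move=> N0 B0 a0 aA aB.
apply: lime_le; first by apply: is_cvg_nneseries => n _ _; rewrite lee_fin.
near=> m; rewrite sumEFin lee_fin.
have Nm : (N <= m)%N by near: m; exists N.
rewrite (big_cat_nat (leq0n N) Nm)/=; apply: lerD.
  rewrite big_mkord; apply: (@le_trans _ _ (\sum_(i < N) A)).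
    by apply: ler_sum => i _; exact: aA.
  by rewrite sumr_const card_ord mulr_natl.
apply: (@le_trans _ _ (\sum_(N <= n < m) B / n%:R ^+ 2)).
  by apply: ler_sum_nat => n /andP[+ _]; exact: aB.
rewrite -mulr_sumr (mulrC 2) -mulrA ler_wpM2l//.
have := @sum_inv_sqr_le R N (m - N) N0; rewrite subnKC// => /le_trans; apply.
by rewrite ler_pM2l// gerBl invr_ge0 ler0n.
Unshelve. all: by end_near. Qed.

(** * The theta series and its difference *)

Lemma is_cvg_theta3_series (R : realType) (z q : R) : 0 <= q < 1 ->
  cvgn (series (fun n : nat => q ^+ (n ^ 2)%N * cos (2 * n%:R * z))).
Proof.
move=> /andP[q0 q1]; apply: normed_cvg.
apply: (@series_le_cvg R _ (geometric 1 q)) => [n|n|n|].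
- exact: normr_ge0.
- by rewrite /= mul1r exprn_ge0.
- rewrite /= mul1r normrM (ger0_norm (exprn_ge0 _ q0)).
  apply: (@le_trans _ _ (q ^+ (n ^ 2)%N)).
    by rewrite ler_piMr ?exprn_ge0// cos_max.
  by apply: ler_wiXn2l => //; [exact: ltW|case: n => // n; rewrite leq_pmull].
- by apply: is_cvg_geometric_series; rewrite ger0_norm.
Qed.

(** Putting the n = 0 term, which is 1, back into the sum makes it a series
    indexed from 0, to which the general results on series apply. *)
Lemma theta3E (R : realType) (z q : R) : 0 <= q < 1 ->
  theta3 z q =
    2 * limn (series (fun n : nat => q ^+ (n ^ 2)%N * cos (2 * n%:R * z))) - 1.
Proof.
move=> q01; set u := (fun n : nat => _).
have cu : series u @ \oo --> limn (series u) by exact: is_cvg_theta3_series.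
rewrite /theta3 (@cvg_lim _ _ _ _ _ _ (limn (series u) - 1))//; first by ring.
have : series u n - 1 @[n --> \oo] --> limn (series u) - 1.
  by apply: cvgB cu _; exact: cvg_cst.
apply: cvg_trans; apply: near_eq_cvg.
near=> n; rewrite /series/= (@big_ltn _ _ _ 0%N); last by near: n; exists 1%N.
by rewrite /u /= exp0n// expr0 mul1r mulr0 mul0r cos0 addrC addKr.
Unshelve. all: by end_near. Qed.

Definition g_term (R : realType) (theta : R) (n : nat) (tau : R) : R :=
  4 * sin (n%:R * theta) ^+ 2 * expR (- (theta * n%:R ^+ 2 * tau)).

Lemma g_term_ge0 (R : realType) (theta : R) n (tau : R) : 0 <= g_term theta n tau.
Proof. by rewrite /g_term !(sqr_ge0, expR_ge0, mulr_ge0). Qed.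

(** Mode n has weight 2 (1 - cos (2 n theta)) = 4 sin^2 (n theta); the mode n = 0,
    absent from the theta series, has weight 0. *)
Lemma g_series (R : realType) (theta tau : R) : 0 < theta -> 0 < tau ->
  ((g theta tau)%:E = \sum_(0 <= n <oo) (g_term theta n tau)%:E)%E.
Proof.
move=> t0 s0; set q := expR (- (theta * tau)).
have q01 : 0 <= q < 1.
  by rewrite expR_ge0 -expR0 ltr_expR oppr_lt0 mulr_gt0.
rewrite /g -/q !theta3E//.
set u0 := series _; set u1 := series _.
have c0 : cvgn u0 by exact: is_cvg_theta3_series.
have c1 : cvgn u1 by exact: is_cvg_theta3_series.
have cD : 2 * (u0 n - u1 n) @[n --> \oo] --> 2 * (limn u0 - limn u1).
  by apply: cvgMl_tmp; exact: cvgB.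
have -> : 2 * limn u0 - 1 - (2 * limn u1 - 1) = limn (fun n => 2 * (u0 n - u1 n)).
  by rewrite (cvg_lim _ cD)//; ring.
rewrite -EFin_lim; last by apply/cvg_ex; eexists; exact: cD.
congr (limn _); apply/funext => n /=; rewrite sumEFin; congr EFin.
rewrite /g_term /u0 /u1 /series/= -sumrB mulr_sumr; apply: eq_bigr => k _.
have -> : 2 * k%:R * theta = (k%:R * theta) *+ 2 by rewrite -mulr_natl; ring.
rewrite mulr0 cos0 cos_mulr2n cos2sin2 -expRM_natl natrX.
have -> : - (theta * k%:R ^+ 2 * tau) = k%:R ^+ 2 * - (theta * tau) by ring.
by ring.
Qed.

Lemma g_ge0 (R : realType) (theta tau : R) : 0 < theta -> 0 < tau ->
  0 <= g theta tau.
Proof.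
move=> t0 s0; rewrite -lee_fin g_series//; apply: nneseries_ge0 => n _ _.
by rewrite lee_fin; exact: g_term_ge0.
Qed.

(** * Termwise integration *)

Lemma continuous_expRNM (R : realType) (a : R) :
  continuous (fun x : R => expR (- (a * x))).
Proof.
move=> x; apply: continuous_comp; last exact: continuous_expR.
by apply: cvgN; apply: cvgMl_tmp; exact: cvg_id.
Qed.

Lemma measurable_expRNM (R : realType) (a : R) (D : set R) :
  measurable_fun D (fun x : R => (expR (- (a * x)))%:E).
Proof.
apply/measurable_EFinP; apply: measurable_funTS.
by apply: continuous_measurable_fun; exact: continuous_expRNM.
Qed.

Lemma integral_expR_itvoy (R : realType) (a d : R) : 0 < a ->
  (\int[lebesgue_measure]_(x in `]d, +oo[) (expR (- (a * x)))%:E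
   = (expR (- (a * d)) / a)%:E)%E.
Proof.
move=> a0.
have dF (x : R) : is_derive x 1 (fun x : R => - (expR (- (a * x)) / a)) (expR (- (a * x))).
  apply: is_derive_eq; rewrite /GRing.scale/=; field; exact: lt0r_neq0.
rewrite integral_itv_obnd_cbnd; last exact: measurable_expRNM.
rewrite (@ge0_continuous_FTC2y R _ (fun x => - (expR (- (a * x)) / a)) d 0).
- by rewrite -EFinB sub0r opprK.
- by move=> x _; exact: expR_ge0.
- by apply: continuous_subspaceT; exact: continuous_expRNM.
- rewrite -oppr0 -[X in - X](mul0r a^-1); apply: cvgN; apply: cvgMr_tmp.
  apply: (@cvg_comp _ _ _ (fun x => a * x) (fun y => expR (- y)) _ (pinfty_nbhs R));
    last exact: cvgr_expR.
  exact: gt0_cvgMry a0 cvg_id.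
- by move=> x _; have [] := dF x.
- apply: cvg_at_right_filter; apply: cvgN; apply: cvgMr_tmp; exact: continuous_expRNM.
- by move=> x _; rewrite derive1E; have [] := dF x.
Qed.

(** The integral of [g_term theta n] over `]d, +oo[; at n = 0, where the division
    is by 0, the formula gives the right value 0 because the sine vanishes. *)
Definition g_term_tail (R : realType) (theta d : R) (n : nat) : R :=
  4 * sin (n%:R * theta) ^+ 2 *
    (expR (- (theta * n%:R ^+ 2 * d)) / (theta * n%:R ^+ 2)).

Lemma g_term_tail0 (R : realType) (theta d : R) : g_term_tail theta d 0 = 0.
Proof. by rewrite /g_term_tail mul0r sin0 expr0n/= mulr0 mul0r. Qed.

Lemma measurable_g_term (R : realType) (theta : R) n (D : set R) :
  measurable_fun D (fun tau => (g_term theta n tau)%:E).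
Proof.
by apply/measurable_EFinP; apply: measurable_funM => //; apply/measurable_EFinP;
  exact: measurable_expRNM.
Qed.

Lemma integral_g_term (R : realType) (theta d : R) n : 0 < theta ->
  (\int[lebesgue_measure]_(tau in `]d, +oo[) (g_term theta n tau)%:E =
   (g_term_tail theta d n)%:E)%E.
Proof.
move=> t0; case: n => [|n].
  rewrite g_term_tail0.
  by apply: integral0_eq => x _; rewrite /g_term mul0r sin0 expr0n/= mulr0 mul0r.
under eq_integral do rewrite /g_term EFinM.
rewrite ge0_integralZl_EFin//.
- by rewrite integral_expR_itvoy ?mulr_gt0 ?exprn_gt0 ?ltr0n.
- exact: measurable_expRNM.
- by rewrite mulr_ge0// sqr_ge0.
Qed.

Lemma integral_g (R : realType) (theta d : R) : 0 < theta -> 0 <= d ->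
  (\int[lebesgue_measure]_(tau in `]d, +oo[) (g theta tau)%:E =
   \sum_(0 <= n <oo) (g_term_tail theta d n)%:E)%E.
Proof.
move=> t0 d0.
transitivity (\int[lebesgue_measure]_(tau in `]d, +oo[)
    \sum_(0 <= n <oo) (g_term theta n tau)%:E)%E.
  apply: eq_integral => x; rewrite inE/= in_itv/= andbT => dx.
  by rewrite g_series//; exact: le_lt_trans dx.
rewrite integral_nneseries//.
- by apply: eq_eseriesr => n _; exact: integral_g_term.
- by move=> n; exact: measurable_g_term.
- by move=> n x _; rewrite lee_fin g_term_ge0.
Qed.

Lemma measurable_g (R : realType) (theta : R) : 0 < theta ->
  measurable_fun (`]0, +oo[ : set R) (fun tau => (g theta tau)%:E).
Proof.
move=> t0.
apply: (@eq_measurable_fun _ _ _ _ _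
    (fun tau => \sum_(0 <= n <oo | n \in predT) (g_term theta n tau)%:E)%E).
  by move=> x; rewrite inE/= in_itv/= andbT => x0; rewrite g_series.
apply: ge0_emeasurable_sum => [n x _ _|n _]; first by rewrite lee_fin g_term_ge0.
exact: measurable_g_term.
Qed.

(** * Size of the modes *)

Lemma g_term_tail_ge0 (R : realType) (theta d : R) n : 0 < theta ->
  0 <= g_term_tail theta d n.
Proof.
move=> t0; rewrite /g_term_tail !(sqr_ge0, expR_ge0, mulr_ge0)// invr_ge0.
by rewrite mulr_ge0 ?sqr_ge0// ltW.
Qed.

Lemma g_term_tail_le_theta_expR (R : realType) (theta d : R) n : 0 < theta ->
  g_term_tail theta d n <= 4 * theta * expR (- (theta * n%:R ^+ 2 * d)).
Proof.
move=> t0; case: n => [|n].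
  by rewrite g_term_tail0 !(expR_ge0, mulr_ge0)// ltW.
rewrite /g_term_tail; set x : R := n.+1%:R; set e := expR _.
have x0 : 0 < x by rewrite ltr0n.
have e0 : 0 <= e by exact: expR_ge0.
have -> : 4 * theta * e = 4 * (x * theta) ^+ 2 * (e / (theta * x ^+ 2)).
  by field; rewrite !gt_eqF.
apply: ler_wpM2r; first by rewrite divr_ge0// mulr_ge0 ?sqr_ge0// ltW.
by rewrite ler_pM2l// sqr_sin_le_sqr// mulr_ge0// ltW.
Qed.

Lemma g_term_tail_le_theta (R : realType) (theta d : R) n : 0 < theta -> 0 <= d ->
  g_term_tail theta d n <= 4 * theta.
Proof.
move=> t0 d0; apply: le_trans (g_term_tail_le_theta_expR _ _ t0) _.
by rewrite ler_piMr ?mulr_ge0 ?(ltW t0)// expR_le1 oppr_le0 !(sqr_ge0, mulr_ge0)// ltW.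
Qed.

(** The decay in n is uniform in theta: expR (- y) <= 1 / y, and the theta in
    y = theta * n ^ 2 * d cancels the one in front. *)
Lemma g_term_tail_le_inv_sqr (R : realType) (theta d : R) n : 0 < theta -> 0 < d ->
  (0 < n)%N -> g_term_tail theta d n <= 4 / d / n%:R ^+ 2.
Proof.
move=> t0 d0 n0; apply: le_trans (g_term_tail_le_theta_expR _ _ t0) _.
have x0 : 0 < n%:R :> R by rewrite ltr0n.
set y := theta * _ * d; have y0 : 0 < y by rewrite !mulr_gt0 ?exprn_gt0.
have -> : 4 / d / n%:R ^+ 2 = 4 * theta * y^-1.
  by rewrite /y; field; rewrite !gt_eqF.
rewrite ler_pM2l ?mulr_gt0// expRN lef_pV2 ?posrE ?expR_gt0//.
by have := expR_ge1Dx y; lra.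
Qed.

Lemma g_term_tail_at0_le (R : realType) (theta : R) n : 0 < theta ->
  g_term_tail theta 0 n <= 4 / theta / n%:R ^+ 2.
Proof.
move=> t0; rewrite /g_term_tail mulr0 oppr0 expR0 mul1r.
rewrite -[leRHS]mulrA -invfM; apply: ler_wpM2r.
  by rewrite invr_ge0 !(sqr_ge0, mulr_ge0)// ltW.
by have := cos2Dsin2 (n%:R * theta); have := sqr_ge0 (cos (n%:R * theta)); lra.
Qed.

(** * Bounds on the integrals *)

Lemma integral_g_tail_le (R : realType) (theta d : R) (N : nat) :
  0 < theta -> 0 < d -> (0 < N)%N ->
  (\int[lebesgue_measure]_(tau in `]d, +oo[) (g theta tau)%:E <=
   (N%:R * (4 * theta) + 2 * (4 / d) / N%:R)%:E)%E.
Proof.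
move=> t0 d0 N0; rewrite (integral_g t0 (ltW d0)); apply: nneseries_le_head_tail => //.
- by rewrite divr_ge0// ltW.
- by move=> n; exact: g_term_tail_ge0.
- by move=> n _; apply: g_term_tail_le_theta; rewrite // ltW.
- by move=> n Nn; apply: g_term_tail_le_inv_sqr => //; exact: leq_trans Nn.
Qed.

Lemma integral_g_lty (R : realType) (theta : R) : 0 < theta ->
  (\int[lebesgue_measure]_(tau in `]0%R, +oo[) (g theta tau)%:E < +oo)%E.
Proof.
move=> t0; rewrite integral_g//; apply: le_lt_trans (ltry _).
apply: (@nneseries_le_head_tail R _ 0 (4 / theta) 1) => //.
- by rewrite divr_ge0// ltW.
- by move=> n; exact: g_term_tail_ge0.
- by case=> // _; rewrite g_term_tail0.
- by move=> n _; exact: g_term_tail_at0_le.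
Qed.

Lemma integrable_g (R : realType) (theta : R) : 0 < theta ->
  lebesgue_measure.-integrable `]0, +oo[ (fun tau : R => (g theta tau)%:E).
Proof.
move=> t0; apply/integrableP; split; first exact: measurable_g.
have -> : (\int[lebesgue_measure]_(tau in `]0%R, +oo[) `|(g theta tau)%:E| =
    \int[lebesgue_measure]_(tau in `]0%R, +oo[) (g theta tau)%:E)%E;
  last exact: integral_g_lty.
apply: eq_integral => x; rewrite inE/= in_itv/= andbT => x0.
by rewrite ger0_norm ?g_ge0.
Qed.

(** The modes 1 <= n <= 1 / theta each contribute at least
    4 * theta * cos 1 ^ 2, and there are at least 1 / (2 * theta) of them. *)
Lemma integral_g_total_ge (R : realType) (theta : R) : 0 < theta <= 1 ->
  ((2 * cos 1 ^+ 2)%:E <=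
   \int[lebesgue_measure]_(tau in `]0%R, +oo[) (g theta tau)%:E)%E.
Proof.
move=> /andP[t0 t1]; rewrite integral_g//.
have ti0 : 0 <= theta^-1 by rewrite invr_ge0 ltW.
set M := Num.truncn theta^-1.
have /andP[Ml Mu] : M%:R <= theta^-1 < M.+1%:R by exact: truncn_itv.
apply: le_trans (nneseries_lim_ge M.+1 _); last first.
  by move=> n _ _; rewrite lee_fin g_term_tail_ge0.
rewrite sumEFin lee_fin big_nat_recl// g_term_tail0 add0r.
apply: (@le_trans _ _ (\sum_(0 <= n < M) 4 * theta * cos 1 ^+ 2)).
  rewrite sumr_const_nat subn0 -mulr_natl.
  have : 1 / 2 <= M%:R * theta.
    have M1 : 1 <= M%:R :> R by rewrite ler1n truncn_gt0 invf_ge1.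
    move: Mu; rewrite -natr1 -[X in X < _]div1r ltr_pdivrMr//; nra.
  have := sqr_ge0 (cos 1 : R); nra.
apply: ler_sum_nat => n /andP[_ nM].
rewrite /g_term_tail mulr0 oppr0 expR0 mul1r; set x : R := n.+1%:R.
have x0 : 0 < x by rewrite ltr0n.
have -> : 4 * theta * cos 1 ^+ 2 = 4 * (cos 1 * (x * theta)) ^+ 2 / (theta * x ^+ 2).
  by field; rewrite !gt_eqF.
apply: ler_wpM2r; first by rewrite invr_ge0 mulr_ge0 ?sqr_ge0 ?ltW.
rewrite ler_pM2l// sqr_sin_ge// mulr_ge0 ?(ltW x0) ?(ltW t0)//=.
by rewrite -ler_pdivlMr// div1r (le_trans _ Ml)// ler_nat.
Qed.

Theorem proposition7p3 (R : realType) (delta : R) (delta_gt0 : 0 < delta) :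
  (\forall theta \near (0 : R)^'+,
     lebesgue_measure.-integrable `]0, +oo[ (fun tau : R => (g theta tau)%:E) /\
     (\int[lebesgue_measure]_(tau in `]0, +oo[) g theta tau)%R != 0) /\
  ((fun theta : R =>
      \int[lebesgue_measure]_(tau in `]delta, +oo[) (g theta tau) /
      \int[lebesgue_measure]_(tau in `]0, +oo[) (g theta tau))
     theta @[theta --> (0 : R)^'+] --> (0 : R)).
Proof.
pose K : R := 2 * cos 1 ^+ 2.
have K0 : 0 < K by rewrite mulr_gt0// exprn_gt0// cos1_gt0.
have total_ge (theta : R) : 0 < theta <= 1 ->
    K <= \int[lebesgue_measure]_(tau in `]0, +oo[) g theta tau.
  move=> /andP[t0 t1]; rewrite -lee_fin /Rintegral fineK ?integral_g_total_ge ?t0//.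
  by apply: integrable_fin_num => //; exact: integrable_g.
clearbody K; split.
  near=> theta; split; first by apply: integrable_g; near: theta; exact: nbhs_right_gt.
  rewrite gt_eqF// (lt_le_trans K0)// total_ge//; apply/andP; split.
    by near: theta; exact: nbhs_right_gt.
  by near: theta; exact: nbhs_right_ltW.
apply/cvgr0Pnorm_lt => eps eps0.
(* This N brings the modes n >= N below half of the target eps * K. *)
pose N := (Num.truncn (16 / (delta * eps * K))).+1.
have N0 : 0 < N%:R :> R by rewrite ltr0n.
have Nlarge : 2 * (4 / delta) / N%:R < eps * K / 2.
  have : 16 / (delta * eps * K) < N%:R.
    have /truncn_itv/andP[] // : 0 <= 16 / (delta * eps * K).
    by rewrite divr_ge0// !mulr_ge0// ltW.
  rewrite ltr_pdivrMr ?mulr_gt0// => H.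
  have -> : 2 * (4 / delta) / N%:R = 8 / (delta * N%:R).
    by field; rewrite !gt_eqF.
  by rewrite ltr_pdivrMr ?mulr_gt0//; nra.
near=> theta.
have t0 : 0 < theta by near: theta; exact: nbhs_right_gt.
have t1 : theta <= 1 by near: theta; exact: nbhs_right_ltW.
(* Keeps the modes n < N, at most 4 * N * theta in all, below the other half. *)
have tN : theta < eps * K / (8 * N%:R).
  by near: theta; apply: nbhs_right_lt; rewrite divr_gt0 ?mulr_gt0.
have D0 : K <= \int[lebesgue_measure]_(tau in `]0, +oo[) g theta tau.
  by rewrite total_ge// t0.
have I0 : (0 <= \int[lebesgue_measure]_(tau in `]delta, +oo[) (g theta tau)%:E)%E.
  apply: integral_ge0 => x; rewrite /= in_itv/= andbT => dx.
  by rewrite lee_fin g_ge0// (lt_trans delta_gt0).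
have := integral_g_tail_le t0 delta_gt0 (ltn0Sn _ : (0 < N)%N) => Ile.
rewrite ger0_norm; last first.
  by apply: divr_ge0; [exact: fine_ge0 | exact: le_trans (ltW K0) D0].
rewrite ltr_pdivrMr; last exact: lt_le_trans D0.
apply: (@lt_le_trans _ _ (eps * K)); last by rewrite ler_pM2l.
rewrite -lte_fin /Rintegral fineK; last first.
  by rewrite ge0_fin_numE// (le_lt_trans Ile)// ltry.
apply: (le_lt_trans Ile); rewrite lte_fin.
move: tN; rewrite ltr_pdivlMr ?mulr_gt0// => tN.
by nra.
Unshelve. all: by end_near. Qed.
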